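(* Consider a mixed integer problem, its Dantzig-Wolfe relaxation, its linear-hull relaxation and its LP relaxation, with optimal values $Z^{IP}, Z^{DW}, Z^{LIN}, Z^{LP}$ as defined in the context. Then $$Z^{IP} \le Z^{DW} \le Z^{LIN} \le Z^{LP}.$$ If $\operatorname{conv}(P) = \{z : Az \le b\}$, then $Z^{DW} = Z^{LIN} = Z^{LP}$. Moreover, there exists an instance for which all of these inequalities are strict, i.e. $Z^{IP} < Z^{DW} < Z^{LIN} < Z^{LP}$.
   Context: Let $c\in\mathbb{R}^n$, $d\in\mathbb{R}^m$, let $A,H,G$ be real matrices and $b,h$ real vectors of compatible dimensions. It is assumed that the system $Az\le b$ includes the bounds $0\le z\le 1$. The variables $u\in\mathbb{R}^m$ are free. Let $P=\{z\in\{0,1\}^n : Az\le b\}$, let $\operatorname{lin}(P)$ denote the linear subspace of $\mathbb{R}^n$ spanned by $P$, and $\operatorname{conv}(P)$ the convex hull of $P$. Define (as suprema, with value $-\infty$ if infeasible) $$Z^{IP}=\max\{c'z+d'u : Az\le b,\ Hz+Gu\le h,\ z\in\{0,1\}^n\},$$ $$Z^{DW}=\max\{c'z+d'u : Az\le b,\ Hz+Gu\le h,\ z\in\operatorname{conv}(P)\},$$ $$Z^{LIN}=\max\{c'z+d'u : Az\le b,\ Hz+Gu\le h,\ z\in\operatorname{lin}(P)\},$$ $$Z^{LP}=\max\{c'z+d'u : Az\le b,\ Hz+Gu\le h\}.$$ An instance consists of the data $(A,b,H,G,h,c,d)$; the case with no $u$ variables is allowed. *)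

(* Defs.v *)
From HB Require Import structures.
From mathcomp Require Import all_boot all_order all_algebra.
From mathcomp Require Import all_classical all_reals all_analysis.

Set Implicit Arguments.
Unset Strict Implicit.
Unset Printing Implicit Defensive.

Import Order.TTheory GRing.Theory Num.Theory.

Local Open Scope classical_set_scope.
Local Open Scope ring_scope.

Definition lecv (R : realType) (k : nat) (x y : 'cV[R]_k) : Prop :=
  forall i, x i 0 <= y i 0.

Definition dotcv (R : realType) (k : nat) (x y : 'cV[R]_k) : R :=
  (x^T *m y) 0 0.

(* [smallest C X] is the intersection of all the sets that satisfy [C] and
   contain [X]. *)
Definition conv_hull (R : realType) (V : lmodType R) (X : set V) : set V :=
  smallest (@convex_set R V) X.

Definition lin_hull (R : realType) (V : lmodType R) (X : set V) : set V :=
  smallest (fun S : set V => submod_closed (mem S)) X.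

(* The system A z <= b contains, among its rows, the inequalities z_j <= 1 and
   - z_j <= 0 for every j. *)
Definition includes_bounds (R : realType) (n p : nat)
    (A : 'M[R]_(p, n)) (b : 'cV[R]_p) : Prop :=
  forall j : 'I_n,
    (exists i, row i A = delta_mx 0 j /\ b i 0 = 1) /\
    (exists i, row i A = - delta_mx 0 j /\ b i 0 = 0).

Record mip_instance (R : realType) := MipInstance {
  nz : nat; (* number of binary variables z *)
  nu : nat; (* number of free variables u, possibly 0 *)
  nA : nat; (* number of rows of A z <= b *)
  nH : nat; (* number of rows of H z + G u <= h *)
  matA : 'M[R]_(nA, nz);
  vecb : 'cV[R]_nA;
  matH : 'M[R]_(nH, nz);
  matG : 'M[R]_(nH, nu);
  vech : 'cV[R]_nH;
  vecc : 'cV[R]_nz;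
  vecd : 'cV[R]_nu;
  matA_bounds : includes_bounds matA vecb
}.

Section Values.
Variables (R : realType) (I : mip_instance R).

Definition binary_vectors : set 'cV[R]_(nz I) :=
  [set z | forall j, z j 0 = 0 \/ z j 0 = 1].

Definition polyA : set 'cV[R]_(nz I) :=
  [set z | lecv (matA I *m z) (vecb I)].

Definition binary_polyA : set 'cV[R]_(nz I) := binary_vectors `&` polyA.

Definition feasible (X : set 'cV[R]_(nz I)) :
    set ('cV[R]_(nz I) * 'cV[R]_(nu I)) :=
  [set zu | [/\ lecv (matA I *m zu.1) (vecb I),
                lecv (matH I *m zu.1 + matG I *m zu.2) (vech I)
              & X zu.1]].

(* [ereal_sup set0 = -oo], the convention for infeasible problems. *)
Definition opt_value (X : set 'cV[R]_(nz I)) : \bar R :=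
  ereal_sup [set (dotcv (vecc I) zu.1 + dotcv (vecd I) zu.2)%:E
            | zu in feasible X].

Definition Z_IP : \bar R := opt_value binary_vectors.
Definition Z_DW : \bar R := opt_value (conv_hull binary_polyA).
Definition Z_LIN : \bar R := opt_value (lin_hull binary_polyA).
Definition Z_LP : \bar R := opt_value setT.

End Values.

Arguments binary_vectors {R} I _.
Arguments polyA {R} I _.
Arguments binary_polyA {R} I _.

(* Main.v *)
Require Import Defs.
From mathcomp Require Import all_boot all_order all_algebra.
From mathcomp Require Import all_classical all_reals all_analysis.
From mathcomp Require Import ring lra.

(** The four problems maximize the same objective over the same linear
constraints and differ only in the set to which [z] is confined, so the chain
of inequalities is the chain of inclusions
[P <= conv P <= lin P <= everything], a linear subspace being convex.  If
[conv P] is the whole polyhedron [A z <= b], the last problem is no larger than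
the second one and the chain collapses ([Z_LP_le_Z_DW]).

The strict instance lives in dimension 3 and has no free variable.  Besides the
bounds, [A z <= b] has the row [2 z_0 + 2 z_1 + 4 z_2 <= 3], which leaves
[P = {0, e_0, e_1}]; hence [conv P] is a triangle in the plane [z_2 = 0] and
[lin P] is that plane.  The linking constraint is [2 z_0 <= 1] and the objective
is [2 z_0 + z_1 + 4 z_2].  The relaxations are then separated as follows:
- over [P] the linking constraint removes [e_0], and the value is at most 1;
- over [conv P] the value is 3/2: it is reached at [(1/2, 1/2, 0)], and it is
  the sum of the bounds [z_0 <= 1/2] and [z_0 + z_1 <= 1], as [z_2 = 0];
- over [lin P] the value is 2: it is reached at [(1/2, 1, 0)], and it is the sum
  of the bounds [z_0 <= 1/2] and [z_0 + z_1 <= 3/2], the latter being the row of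
  [A] when [z_2 = 0];
- without restriction the point [(0, 0, 3/4)] has value 3. *)

Set Implicit Arguments.
Unset Strict Implicit.
Unset Printing Implicit Defensive.

Import Order.TTheory GRing.Theory Num.Theory.

Local Open Scope classical_set_scope.
Local Open Scope ring_scope.

(** * Hulls *)

(** Closure under [a *: u + v] is used twice, with [v = 0] the first time. *)
Lemma submod_closed_convex_set (R : realType) (V : lmodType R) (S : set V) :
  submod_closed (mem S) -> convex_set S.
Proof.
move=> [S0 Slin] x y t Sx Sy; apply: (Slin) => //.
by rewrite -[X in X \in _]addr0; apply: Slin.
Qed.

Lemma conv_hull_sub_lin_hull (R : realType) (V : lmodType R) (X : set V) :
  conv_hull X `<=` lin_hull X.
Proof.
(* The convex hull is an intersection over a larger family of sets. *)
by apply: sub_smallest2l => S; apply: submod_closed_convex_set.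
Qed.

Lemma conv_hull_convex (R : realType) (V : lmodType R) (X : set V) x y (t : R) :
  0 <= t <= 1 -> X x -> X y -> conv_hull X (t *: x + (1 - t) *: y).
Proof.
move=> /andP[t0 t1] Xx Xy S [Sconv XS]; rewrite -inE.
by apply: (Sconv x y (Itv01 t0 t1)); rewrite inE; apply: XS.
Qed.

Lemma lin_hull_lin (R : realType) (V : lmodType R) (X : set V) x y (t : R) :
  X x -> X y -> lin_hull X (t *: x + y).
Proof.
move=> Xx Xy S [[_ Slin] XS]; rewrite -inE.
by apply: Slin; rewrite inE; apply: XS.
Qed.

(** * Optimal values *)

Section OptValue.
Variables (R : realType) (I : mip_instance R).
Implicit Types X Y : set 'cV[R]_(nz I).

(** Feasible points satisfy [A z <= b], so [X] and [Y] are compared inside that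
polyhedron only; the collapse when [conv P] is the polyhedron rests on this. *)
Lemma opt_value_le X Y :
  polyA I `&` X `<=` Y -> (opt_value X <= opt_value Y)%E.
Proof.
move=> XY; apply: ereal_sup_le; apply: image_subset => zu [Az Hz Xz].
by split=> //; apply: XY.
Qed.

Lemma opt_value_ge X zu (v : R) : feasible X zu ->
  v <= dotcv (vecc I) zu.1 + dotcv (vecd I) zu.2 -> (v%:E <= opt_value X)%E.
Proof.
move=> Xzu le_v; apply: le_ereal_sup_tmp.
by exists (dotcv (vecc I) zu.1 + dotcv (vecd I) zu.2)%:E; [exists zu|].
Qed.

Lemma opt_value_ub X (v : R) :
  (forall zu, feasible X zu ->
     dotcv (vecc I) zu.1 + dotcv (vecd I) zu.2 <= v) ->
  (opt_value X <= v%:E)%E.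
Proof. by move=> le_v; apply: ge_ereal_sup => _ [zu /le_v ? <-]. Qed.

Lemma Z_IP_le_Z_DW : (Z_IP I <= Z_DW I)%E.
Proof. by apply: opt_value_le => z [Az bz]; apply: sub_gen_smallest. Qed.

Lemma Z_DW_le_Z_LIN : (Z_DW I <= Z_LIN I)%E.
Proof. by apply: opt_value_le => z [_]; apply: conv_hull_sub_lin_hull. Qed.

Lemma Z_LIN_le_Z_LP : (Z_LIN I <= Z_LP I)%E.
Proof. exact: opt_value_le. Qed.

Lemma Z_LP_le_Z_DW :
  conv_hull (binary_polyA I) = polyA I -> (Z_LP I <= Z_DW I)%E.
Proof. by move=> convP; apply: opt_value_le => z [Az _]; rewrite convP. Qed.

End OptValue.

(** * An instance with strict inequalities *)

Section StrictInstance.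
Variable R : realType.

Definition cv3 (x y t : R) : 'cV[R]_3 := \col_i [:: x; y; t]`_i.

Lemma dotcv_cv3 x y t (z : 'cV[R]_3) :
  dotcv (cv3 x y t) z =
  x * z 0 0 + y * z (lift ord0 ord0) 0 + t * z (lift ord0 (lift ord0 ord0)) 0.
Proof. by rewrite /dotcv mxE !big_ord_recl big_ord0 !mxE /= addr0 addrA. Qed.

Lemma lecv_col_mx p q (x1 y1 : 'cV[R]_p) (x2 y2 : 'cV[R]_q) :
  lecv (col_mx x1 x2) (col_mx y1 y2) <-> lecv x1 y1 /\ lecv x2 y2.
Proof.
split=> [le_xy|[le1 le2] i].
  split=> i; first by have := le_xy (lshift q i); rewrite !col_mxEu.
  by have := le_xy (rshift p i); rewrite !col_mxEd.
by case: (split_ordP i) => j ->; rewrite ?col_mxEu ?col_mxEd.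
Qed.

Lemma lecv_row_mul n (c z : 'cV[R]_n) (t : R) :
  lecv (c^T *m z) t%:M <-> dotcv c z <= t.
Proof.
split=> [/(_ 0)|le_t i]; first by rewrite [X in _ <= X]mxE.
by rewrite !ord1 [X in _ <= X]mxE.
Qed.

Definition strict_A : 'M[R]_(3 + 3 + 1, 3) :=
  col_mx (col_mx 1%:M (- 1%:M)) (cv3 2 2 4)^T.

Definition strict_b : 'cV[R]_(3 + 3 + 1) :=
  col_mx (col_mx (const_mx 1) 0) 3%:M.

Lemma strict_A_bounds : includes_bounds strict_A strict_b.
Proof.
move=> j; split.
  exists (lshift 1 (lshift 3 j)).
  by rewrite /strict_A /strict_b !(rowKu, col_mxEu) row1 mxE.
exists (lshift 1 (rshift 3 j)).
rewrite /strict_A /strict_b !(rowKu, rowKd, col_mxEu, col_mxEd).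
by rewrite linearN /= row1 mxE.
Qed.

Definition strict_instance : mip_instance R :=
  @MipInstance R 3 0 (3 + 3 + 1) 1 strict_A strict_b
    (cv3 2 0 0)^T 0 1%:M (cv3 2 1 4) 0 strict_A_bounds.

Local Notation SI := strict_instance.
Local Notation P := (binary_polyA SI).
(* The indices are written in the form that [big_ord_recl] produces. *)
Local Notation i0 := (ord0 : 'I_3).
Local Notation i1 := (lift ord0 ord0 : 'I_3).
Local Notation i2 := (lift ord0 (lift ord0 ord0) : 'I_3).

Lemma forall_ord3 (Q : 'I_3 -> Prop) :
  (forall i, Q i) <-> [/\ Q i0, Q i1 & Q i2].
Proof.
split=> [Qi|[Q0 Q1 Q2] [[|[|[|//]]] lt_i]]; first by split.
- by rewrite (_ : Ordinal _ = i0) //; apply: val_inj.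
- by rewrite (_ : Ordinal _ = i1) //; apply: val_inj.
- by rewrite (_ : Ordinal _ = i2) //; apply: val_inj.
Qed.

Lemma strict_polyAP (z : 'cV[R]_3) :
  polyA SI z <->
  (forall i, 0 <= z i 0 <= 1) /\ 2 * z i0 0 + 2 * z i1 0 + 4 * z i2 0 <= 3.
Proof.
rewrite /polyA /= /strict_A /strict_b !mul_col_mx !lecv_col_mx lecv_row_mul.
rewrite mul1mx mulNmx mul1mx dotcv_cv3.
split=> [[[le1 ge0] ?]|[z01 ?]]; split=> //.
  move=> i; have := ge0 i; have := le1 i.
  by rewrite !mxE oppr_le0 => -> ->.
by split=> i; have /andP[] := z01 i; rewrite !mxE ?oppr_le0.
Qed.

Lemma strict_feasibleP (X : set 'cV[R]_3) (zu : 'cV[R]_3 * 'cV[R]_0) :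
  @feasible R SI X zu <-> [/\ polyA SI zu.1, 2 * zu.1 i0 0 <= 1 & X zu.1].
Proof.
rewrite /feasible /= mul0mx addr0.
have := lecv_row_mul (cv3 2 0 0) zu.1 1.
rewrite dotcv_cv3 !mul0r !addr0 => HzP.
by split=> -[Az /HzP Hz Xz].
Qed.

Lemma strict_objE (zu : 'cV[R]_3 * 'cV[R]_0) :
  dotcv (vecc SI) zu.1 + dotcv (vecd SI) zu.2 =
  2 * zu.1 i0 0 + zu.1 i1 0 + 4 * zu.1 i2 0.
Proof. by rewrite /= dotcv_cv3 {1}/dotcv trmx0 mul0mx mxE addr0 mul1r. Qed.

(** The row of [A] excludes the binary points with [z_2 = 1], because [4 > 3],
and those with [z_0 = z_1 = 1]. *)
Lemma strict_P_sub z : P z -> z i0 0 + z i1 0 <= 1 /\ z i2 0 = 0.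
Proof.
move=> [zb /strict_polyAP[/forall_ord3[z0 z1 z2] le3]].
have := zb i0; have := zb i1; have := zb i2.
case=> e2; case=> e1; case=> e0; rewrite e0 e1 e2 in z0 z1 z2 le3 *; split=> //.
all: lra.
Qed.

Lemma strict_P_cv3 x y : (x, y) \in [:: (1, 0); (0, 1)] -> P (cv3 x y 0).
Proof.
rewrite !inE => /orP[] /eqP[-> ->]; split.
all: try (apply/forall_ord3; rewrite !mxE /=; split; by [left|right]).
all: apply/strict_polyAP; rewrite forall_ord3 !mxE /= !lexx !ler01.
all: split; [by split|lra].
Qed.

Lemma strict_conv_P_sub z :
  conv_hull P z -> z i0 0 + z i1 0 <= 1 /\ z i2 0 = 0.
Proof.
pose S : set 'cV[R]_3 := [set x | x i0 0 + x i1 0 <= 1 /\ x i2 0 = 0].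
apply: (@smallest_sub _ _ _ S) => [x y t|]; last exact: strict_P_sub.
rewrite !inE => -[x01 x2] [y01 y2].
have t0 : 0 <= t%:num by [].
have t1 : t%:num <= 1 by [].
change (S (t%:num *: x + (1 - t%:num) *: y)).
by rewrite /S /= !mxE x2 y2; split; [nra|ring].
Qed.

Lemma strict_lin_P_sub z : lin_hull P z -> z i2 0 = 0.
Proof.
pose S : set 'cV[R]_3 := [set x | x i2 0 = 0].
apply: (@smallest_sub _ _ _ S) => [|x /strict_P_sub[]//].
split=> [|a x y]; rewrite !inE /S /= !mxE //.
by move=> -> ->; rewrite mulr0 addr0.
Qed.

(** For binary [z_0] the linking constraint [2 z_0 <= 1] forces [z_0 = 0]. *)
Lemma strict_Z_IP_le : (Z_IP SI <= 1%:E)%E.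
Proof.
apply: opt_value_ub => zu /strict_feasibleP[Az Hz bz].
have [z01 z2] := strict_P_sub (conj bz Az).
rewrite strict_objE z2.
by case: (bz i0) => z0; rewrite z0 in Hz z01 *; lra.
Qed.

Lemma strict_Z_DW : Z_DW SI = (3 / 2)%:E.
Proof.
apply/eqP; rewrite eq_le; apply/andP; split.
  apply: opt_value_ub => zu /strict_feasibleP[Az Hz /strict_conv_P_sub[z01 z2]].
  by rewrite strict_objE z2; lra.
apply: (@opt_value_ge R SI _ (2^-1 *: cv3 1 0 0 + (1 - 2^-1) *: cv3 0 1 0, 0)).
  apply/strict_feasibleP; split.
  - by apply/strict_polyAP; rewrite forall_ord3 !mxE /=; split; [split|]; lra.
  - by rewrite !mxE /=; lra.
  - apply: conv_hull_convex; first by lra.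
      by apply: strict_P_cv3; rewrite !inE eqxx.
    by apply: strict_P_cv3; rewrite !inE eqxx orbT.
by rewrite strict_objE !mxE /=; lra.
Qed.

Lemma strict_Z_LIN : Z_LIN SI = 2%:E.
Proof.
apply/eqP; rewrite eq_le; apply/andP; split.
  apply: opt_value_ub => zu /strict_feasibleP[/strict_polyAP[_ Az] Hz].
  by move=> /strict_lin_P_sub z2; rewrite strict_objE z2 in Az *; lra.
apply: (@opt_value_ge R SI _ (2^-1 *: cv3 1 0 0 + cv3 0 1 0, 0)).
  apply/strict_feasibleP; split.
  - by apply/strict_polyAP; rewrite forall_ord3 !mxE /=; split; [split|]; lra.
  - by rewrite !mxE /=; lra.
  - by apply: lin_hull_lin; apply: strict_P_cv3; rewrite !inE eqxx ?orbT.
by rewrite strict_objE !mxE /=; lra.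
Qed.

Lemma strict_Z_LP_ge : (3%:E <= Z_LP SI)%E.
Proof.
apply: (@opt_value_ge R SI _ (cv3 0 0 (3 / 4), 0)).
  apply/strict_feasibleP; split=> //.
  - by apply/strict_polyAP; rewrite forall_ord3 !mxE /=; split; [split|]; lra.
  - by rewrite !mxE /=; lra.
by rewrite strict_objE !mxE /=; lra.
Qed.

End StrictInstance.

Theorem mainTheorem1 (R : realType) :
  (forall I : mip_instance R,
     (Z_IP I <= Z_DW I)%E /\ (Z_DW I <= Z_LIN I)%E /\ (Z_LIN I <= Z_LP I)%E)
  /\ (forall I : mip_instance R,
        conv_hull (binary_polyA I) = polyA I ->
        Z_DW I = Z_LIN I /\ Z_LIN I = Z_LP I)
  /\ (exists I : mip_instance R,
        (Z_IP I < Z_DW I)%E /\ (Z_DW I < Z_LIN I)%E /\ (Z_LIN I < Z_LP I)%E).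
Proof.
split=> [I|]; first by rewrite Z_IP_le_Z_DW Z_DW_le_Z_LIN Z_LIN_le_Z_LP.
split=> [I /Z_LP_le_Z_DW le_LP_DW|].
  have le_DW_LIN := Z_DW_le_Z_LIN I; have le_LIN_LP := Z_LIN_le_Z_LP I.
  split; apply: le_anti; rewrite ?le_DW_LIN ?le_LIN_LP /=.
    exact: le_trans le_LP_DW.
  exact: le_trans le_DW_LIN.
exists (strict_instance R); rewrite strict_Z_DW strict_Z_LIN; split; [|split].
- by apply: le_lt_trans (strict_Z_IP_le R) _; rewrite lte_fin; lra.
- by rewrite lte_fin; lra.
- by apply: lt_le_trans (strict_Z_LP_ge R); rewrite lte_fin; lra.
Qed.
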